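(* Let $P$ be a $d$-prism or a $d$-pyramid with basis $Q$. Then $$m_{\mathcal{P}}(P)=m_{\mathcal{P}}(Q)+1.$$
   Context: A polytope is a bounded intersection of finitely many closed halfspaces; a $k$-polytope is a polytope of dimension $k$. A $d$-polytope $P\subset\mathbb{R}^d$ is called a $d$-pyramid (respectively $d$-prism) with basis $Q$, where $Q$ is a $(d-1)$-polytope, if there exists $v\in\mathbb{R}^d$ such that $P=\mathrm{conv}\{Q,v\}$ (respectively $P=Q+\mathrm{conv}\{0,v\}=\{q+\lambda v : q\in Q,\ 0\le\lambda\le1\}$). For a $d$-dimensional polyhedron $P\subset\mathbb{R}^d$, $m_{\mathcal{P}}(P)$ denotes the minimal number $l$ of polynomials $\mathfrak{p}_1,\dots,\mathfrak{p}_l\in\mathbb{R}[x_1,\dots,x_d]$ such that $P=\{x\in\mathbb{R}^d : \mathfrak{p}_1(x)\ge0,\dots,\mathfrak{p}_l(x)\ge0\}$. For a polyhedron $\tilde P\subset\mathbb{R}^d$ with $\dim(\tilde P)<d$, $m_{\mathcal{P}}(\tilde P)$ is the minimal number of polynomials in $\dim(\tilde P)$ variables needed to describe, in this way, an (affine) embedding of $\tilde P$ in $\mathbb{R}^{\dim(\tilde P)}$ (the number is invariant under regular affine transformations; it is $0$ for a point). *)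

(* Defs.v *)
From mathcomp Require Import all_boot all_order all_algebra.
From mathcomp Require Import boolp classical_sets reals normedtype.
(* Not imported: its notations clash with those of mathcomp-analysis. *)
From mathcomp Require mpoly.

Set Implicit Arguments.
Unset Strict Implicit.
Unset Printing Implicit Defensive.

Import Order.TTheory GRing.Theory Num.Theory.
Import numFieldNormedType.Exports.

Local Open Scope classical_set_scope.
Local Open Scope ring_scope.

(* Points of R^n are row vectors 'rV[R]_n. *)
Section Polytopes.
Variable R : realType.

Definition aff_hull n (S : set 'rV[R]_n) : set 'rV[R]_n :=
  [set y | exists m (x : 'I_m -> 'rV[R]_n) (c : 'I_m -> R),
     [/\ forall i, S (x i), \sum_i c i = 1 & y = \sum_i c i *: x i]].

Definition conv_hull n (S : set 'rV[R]_n) : set 'rV[R]_n :=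
  [set y | exists m (x : 'I_m -> 'rV[R]_n) (c : 'I_m -> R),
     [/\ forall i, S (x i), forall i, 0 <= c i,
         \sum_i c i = 1 & y = \sum_i c i *: x i]].

(* The affine hull of S is a k-dimensional flat a + rowspace(A).  The empty
   set (dimension -1) has no dimension in this sense. *)
Definition has_dim n (S : set 'rV[R]_n) (k : nat) : Prop :=
  exists (a : 'rV[R]_n) (A : 'M[R]_(k, n)),
    row_free A /\ aff_hull S = [set a + u *m A | u in [set: 'rV[R]_k]].

Definition closed_halfspace n (H : set 'rV[R]_n) : Prop :=
  exists (a : 'rV[R]_n) (b : R),
    a != 0 /\ H = [set x | \sum_i a 0 i * x 0 i <= b].

Definition polyhedron n (S : set 'rV[R]_n) : Prop :=
  exists m (H : 'I_m -> set 'rV[R]_n),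
    (forall i, closed_halfspace (H i)) /\ S = \bigcap_(i in [set: 'I_m]) H i.

Definition polytope n (S : set 'rV[R]_n) : Prop :=
  polyhedron S /\ bounded_set S.

Definition kpolytope n (k : nat) (S : set 'rV[R]_n) : Prop :=
  polytope S /\ has_dim S k.

(* Pyramids and prisms live in R^d with d >= 1, written d.+1, so that the
   basis is a polytope of dimension d. *)
Definition pyramid d (P Q : set 'rV[R]_d.+1) : Prop :=
  [/\ kpolytope d.+1 P, kpolytope d Q &
      exists v : 'rV[R]_d.+1, P = conv_hull (Q `|` [set v])].

Definition prism d (P Q : set 'rV[R]_d.+1) : Prop :=
  [/\ kpolytope d.+1 P, kpolytope d Q &
      exists v : 'rV[R]_d.+1,
        P = [set q + l *: v | q in Q & l in [set l : R | 0 <= l <= 1]]].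

Definition described_by n (S : set 'rV[R]_n) (l : nat) : Prop :=
  exists p : 'I_l -> mpoly.mpoly n R,
    S = [set x | forall i, 0 <= mpoly.meval (x 0) (p i)].

Definition affine_embedding n k (S : set 'rV[R]_n)
    (f : 'rV[R]_n -> 'rV[R]_k) : Prop :=
  (exists (A : 'M[R]_(n, k)) (b : 'rV[R]_k), forall x, f x = x *m A + b) /\
  {in aff_hull S &, injective f}.

Definition polynomial_description n (S : set 'rV[R]_n) (l : nat) : Prop :=
  (has_dim S n /\ described_by S l) \/
  (exists k, [/\ (k < n)%N, has_dim S k &
     exists f : 'rV[R]_n -> 'rV[R]_k,
       affine_embedding S f /\ described_by (f @` S) l]).

(* The least number of polynomials; the default value 0 is only taken on sets
   with no polynomial description, hence never on a nonempty polyhedron. *)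
Definition mP n (S : set 'rV[R]_n) : nat :=
  xget 0%N [set l | polynomial_description S l /\
    forall l', polynomial_description S l' -> (l <= l')%N].

End Polytopes.

(* Main.v *)
Require Import Defs.
From mathcomp Require Import all_boot all_order all_algebra.
From mathcomp Require Import boolp classical_sets reals.
From mathcomp Require Import normedtype lra.
From mathcomp Require mpoly.
Import (canonicals, coercions) mpoly.

Set Implicit Arguments.
Unset Strict Implicit.
Unset Printing Implicit Defensive.

Import Order.TTheory GRing.Theory Num.Theory.

Local Open Scope classical_set_scope.
Local Open Scope ring_scope.

(** Let the basis Q lie in the hyperplane t = 0 of coordinates (t, u), chosen
    so that the apex of the pyramid, or the top of the prism, is at t = 1.
    Since polynomial descriptions are transported by affine charts
    ([polynomial_descriptionE]), it suffices to compare the basis Q0 in R^d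
    with the cylinder or the cone C over it in R^(1+d).

    Upper bound.  If Q0 = {F_i >= 0}, the cylinder is cut out by F_i(u) and
    t(1 - t).  For the cone, put s = 1 - t.  The homogenized F_i(u / s) describe
    the slices with s > 0, but they may also accept points with s <= 0, so the last
    inequality has to exclude t < 0 and s < 0 and leave only the apex in s = 0.
    With c chosen such that c |q|^2 <= 1 on Q0 (Q0 is bounded), the inequality
       t (s (1 + s^2) - c |u|^2) >= 0
    does all three: on the open cone c |u|^2 <= s^2 < s (1 + s^2), hence it says
    t >= 0 there; for s <= 0 one has t > 0, and the bracket is nonnegative only
    at s = 0, u = 0 ([described_cone]).

    Lower bound.  In a description C = {F_i >= 0} some F_i vanishes identically
    on t = 0.  Otherwise, Q0 being convex with full affine span and thus
    Zariski dense, all F_i are nonzero, hence positive, at some point of Q0;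
    they remain positive slightly below t = 0, where C has no points.  Setting
    t = 0 and dropping this F_i describes Q0 with one inequality fewer
    ([described_facet]). *)

(** * Polynomial functions *)

Section PolynomialFunctions.
Variable R : realType.

(** Working with functions rather than with formal polynomials makes restriction
    and affine substitution plain composition. *)
Definition polyfun n (f : 'rV[R]_n -> R) : Prop :=
  exists p : mpoly.mpoly n R, forall x, f x = mpoly.meval (x 0) p.

Lemma polyfun_const n (c : R) : polyfun (fun _ : 'rV[R]_n => c).
Proof. by exists (mpoly.mpolyC n c) => x; rewrite mpoly.mevalC. Qed.

Lemma polyfun_coord n (j : 'I_n) : polyfun (fun x : 'rV[R]_n => x 0 j).
Proof. by exists (mpoly.mpolyX R (mpoly.mnm1 j)) => x; rewrite mpoly.mevalXU. Qed.

Lemma polyfunD n (f g : 'rV[R]_n -> R) :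
  polyfun f -> polyfun g -> polyfun (fun x => f x + g x).
Proof. by move=> [p fp] [q gq]; exists (p + q) => x; rewrite mpoly.mevalD fp gq. Qed.

Lemma polyfunM n (f g : 'rV[R]_n -> R) :
  polyfun f -> polyfun g -> polyfun (fun x => f x * g x).
Proof. by move=> [p fp] [q gq]; exists (p * q) => x; rewrite mpoly.mevalM fp gq. Qed.

Lemma polyfunN n (f : 'rV[R]_n -> R) : polyfun f -> polyfun (fun x => - f x).
Proof.
move=> pf; under eq_fun do rewrite -mulN1r.
exact: polyfunM (polyfun_const _ _) pf.
Qed.

Lemma polyfunX n (f : 'rV[R]_n -> R) k : polyfun f -> polyfun (fun x => f x ^+ k).
Proof.
move=> pf; elim: k => [|k IHk]; first exact: polyfun_const.
by under eq_fun do rewrite exprS; exact: polyfunM.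
Qed.

Lemma polyfun_sum n I (r : seq I) (f : I -> 'rV[R]_n -> R) :
  (forall i, polyfun (f i)) -> polyfun (fun x => \sum_(i <- r) f i x).
Proof.
move=> pf; elim: r => [|i r IHr].
  by under eq_fun do rewrite big_nil; exact: polyfun_const.
by under eq_fun do rewrite big_cons; exact: polyfunD.
Qed.

Lemma polyfun_prod n I (r : seq I) (f : I -> 'rV[R]_n -> R) :
  (forall i, polyfun (f i)) -> polyfun (fun x => \prod_(i <- r) f i x).
Proof.
move=> pf; elim: r => [|i r IHr].
  by under eq_fun do rewrite big_nil; exact: polyfun_const.
by under eq_fun do rewrite big_cons; exact: polyfunM.
Qed.

Definition polymap n k (g : 'rV[R]_n -> 'rV[R]_k) : Prop :=
  forall j, polyfun (fun x => g x 0 j).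

Lemma polyfun_comp n k (f : 'rV[R]_k -> R) (g : 'rV[R]_n -> 'rV[R]_k) :
  polyfun f -> polymap g -> polyfun (fun x => f (g x)).
Proof.
move=> [p fp] pg; under eq_fun do rewrite fp mpoly.mevalE.
apply: polyfun_sum => m; apply: polyfunM; first exact: polyfun_const.
by apply: polyfun_prod => i; exact: polyfunX.
Qed.

Lemma polymap_affine n k (b : 'rV[R]_k) (A : 'M[R]_(n, k)) :
  polymap (fun x => b + x *m A).
Proof.
move=> j; under eq_fun do rewrite 2!mxE.
apply: polyfunD; first exact: polyfun_const.
apply: polyfun_sum => i.
exact: polyfunM (polyfun_coord _) (polyfun_const _ _).
Qed.

Lemma polymap_row_mx n k m (f : 'rV[R]_n -> 'rV[R]_k) (g : 'rV[R]_n -> 'rV[R]_m) :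
  polymap f -> polymap g -> polymap (fun x => row_mx (f x) (g x)).
Proof.
move=> pf pg j; under eq_fun do rewrite mxE.
by case: (split j) => i; [exact: pf | exact: pg].
Qed.

Lemma polymap_scalar n (f : 'rV[R]_n -> R) :
  polyfun f -> polymap (fun x => (f x)%:M : 'rV[R]_1).
Proof. by move=> pf j; under eq_fun do rewrite mxE ord1 eqxx mulr1n. Qed.

Lemma polymap_rsubmx k m : polymap (@rsubmx R 1 k m).
Proof. by move=> j; under eq_fun do rewrite mxE; exact: polyfun_coord. Qed.

Lemma polyfun_line n (f : 'rV[R]_n -> R) (x w : 'rV[R]_n) :
  polyfun f -> exists p : {poly R}, forall t, f (x + t *: w) = p.[t].
Proof.
move=> [p fp].
exists (\sum_(m <- mpoly.msupp p) (mpoly.mcoeff m p)%:P *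
  \prod_i ((x 0 i)%:P + (w 0 i) *: 'X) ^+ m i) => t.
rewrite fp mpoly.mevalE horner_sum; apply: eq_bigr => m _.
rewrite hornerM hornerC horner_prod; congr (_ * _); apply: eq_bigr => i _.
by rewrite horner_exp !mxE !hornerE mulrC.
Qed.

(** [h (s, u)] is [s ^ D * f (u / s)].  The exponent [D = msize p] exceeds the
    degree of every monomial of [p], so that each term keeps a factor [s] and [h]
    vanishes at the origin, which is to be the apex of a cone. *)
Lemma polyfun_perspective n (f : 'rV[R]_n -> R) : polyfun f ->
  exists h : 'rV[R]_(1 + n) -> R, [/\ polyfun h, h 0 = 0 &
    forall s u, 0 < s -> (0 <= h (row_mx s%:M u)) = (0 <= f (s^-1 *: u))].
Proof.
move=> [p fp].
pose h (w : 'rV[R]_(1 + n)) := \sum_(m <- mpoly.msupp p)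
  mpoly.mcoeff m p * \prod_i w 0 (rshift 1 i) ^+ m i *
  w 0 0 ^+ (mpoly.msize p - mpoly.mdeg m).
exists h; split.
- apply: polyfun_sum => m; apply: polyfunM; last exact: polyfunX (polyfun_coord _).
  apply: polyfunM; first exact: polyfun_const.
  by apply: polyfun_prod => i; exact: polyfunX (polyfun_coord _).
- rewrite /h big_seq big1 // => m /mpoly.msize_mdeg_lt lt_m.
  by rewrite mxE expr0n subn_eq0 leqNgt lt_m mulr0.
move=> s u s_gt0.
rewrite fp -(pmulr_rge0 (mpoly.meval _ _) (exprn_gt0 (mpoly.msize p) s_gt0)).
congr (0 <= _); rewrite /h mpoly.mevalE mulr_sumr !big_seq; apply: eq_bigr => m.
move=> /mpoly.msize_mdeg_lt /ltnW le_m.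
have -> : (row_mx s%:M u : 'rV_(1 + n)) 0 0 = s.
  by rewrite -(lshift0 n 0) row_mxEl mxE eqxx.
have -> : s ^+ mpoly.msize p = s ^+ (mpoly.msize p - mpoly.mdeg m) * s ^+ mpoly.mdeg m.
  by rewrite -exprD subnK.
have -> : \prod_i (s^-1 *: u) 0 i ^+ m i =
    s ^- mpoly.mdeg m * \prod_i u 0 i ^+ m i.
  rewrite -exprVn mpoly.mdegE expr_sum -big_split /=; apply: eq_bigr => i _.
  by rewrite mxE exprMn.
have s0 : s ^+ mpoly.mdeg m != 0 by rewrite expf_neq0 // gt_eqF.
under eq_bigr do rewrite row_mxEr.
rewrite -!mulrA [in RHS](mulrCA (s ^+ mpoly.mdeg m)) mulVKf //.
by rewrite [RHS]mulrC -mulrA.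
Qed.

End PolynomialFunctions.

(** * Sets described by polynomial inequalities *)

Section Descriptions.
Variable R : realType.

Lemma described_byP n (S : set 'rV[R]_n) l :
  described_by S l <-> exists F : 'I_l -> 'rV[R]_n -> R,
    (forall i, polyfun (F i)) /\ S = [set x | forall i, 0 <= F i x].
Proof.
split=> [[p ->]|[F [/choice[p Fp] ->]]].
  by exists (fun i x => mpoly.meval (x 0) (p i)); split=> // i; exists (p i).
by exists p; apply/seteqP; split=> x /= Fx i; move: (Fx i); rewrite Fp.
Qed.

Lemma described_preimage n k (S : set 'rV[R]_k) (g : 'rV[R]_n -> 'rV[R]_k) l :
  polymap g -> described_by S l -> described_by (g @^-1` S) l.
Proof.
move=> pg /described_byP[F [pF ->]]; apply/described_byP.
by exists (fun i x => F i (g x)); split=> // i; exact: polyfun_comp.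
Qed.

Lemma described_setI n (S : set 'rV[R]_n) (f : 'rV[R]_n -> R) l :
  polyfun f -> described_by S l ->
  described_by (S `&` [set x | 0 <= f x]) l.+1.
Proof.
move=> pf /described_byP[F [pF ->]]; apply/described_byP.
exists (fun i => if unlift ord0 i is Some j then F j else f); split.
  by move=> i; case: unlift.
apply/seteqP; split=> x /= => [[Fx fx] i|Fx]; first by case: unlift.
split=> [i|]; first by have := Fx (lift ord0 i); rewrite liftK.
by have := Fx ord0; rewrite unlift_none.
Qed.

Lemma polyhedron_described n (S : set 'rV[R]_n) :
  polyhedron S -> exists l, described_by S l.
Proof.
move=> [m [H [hsH ->]]]; exists m; apply/described_byP.
have /choice[ab abH] i : exists ab : 'rV[R]_n * R,
    H i = [set x | \sum_j ab.1 0 j * x 0 j <= ab.2].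
  by have [a [b [_ ->]]] := hsH i; exists (a, b).
exists (fun i x => (ab i).2 - \sum_j (ab i).1 0 j * x 0 j); split=> [i|].
  apply: polyfunD; first exact: polyfun_const.
  apply/polyfunN/polyfun_sum => j.
  by apply: polyfunM; [exact: polyfun_const | exact: polyfun_coord].
apply/seteqP; split=> x /=.
  by move=> Hx i; have := Hx i I; rewrite abH /= subr_ge0.
by move=> Hx i _; rewrite abH /= -subr_ge0.
Qed.

Lemma sum1_ord_gt0 m (c : 'I_m -> R) : \sum_i c i = 1 -> (0 < m)%N.
Proof. by case: m c => // c /eqP; rewrite big_ord0 eq_sym oner_eq0. Qed.

Lemma polyhedron_convex n (S : set 'rV[R]_n) :
  polyhedron S -> conv_hull S `<=` S.
Proof.
move=> [m [H [hsH ->]]] y [k [x [c [Sx c_ge0 c1 ->]]]] i _.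
have [a [b [_ Hi]]] := hsH i; rewrite Hi /=.
under eq_bigr do rewrite summxE mulr_sumr.
rewrite exchange_big /= -[b]mul1r -c1 mulr_suml; apply: ler_sum => j _.
have := Sx j i I; rewrite Hi /= => le_b.
apply: le_trans (ler_wpM2l (c_ge0 j) le_b).
by rewrite mulr_sumr; apply: ler_sum => t _; rewrite mxE mulrCA.
Qed.

(** * A convex set with full affine span is Zariski dense *)

(** Bounding [(p i - (p i).[0]) / 'X] on the unit interval gives an explicit
    radius, uniform in the finite family. *)
Lemma poly_pos_near0 (I : finType) (p : I -> {poly R}) :
  (forall i, 0 < (p i).[0]) ->
  exists2 t, 0 < t <= 1 & forall i, 0 < (p i).[t].
Proof.
move=> p_gt0.
have /choice[M Mp] i : exists M, 0 <= M /\
    forall t, 0 <= t <= 1 -> (p i).[0] - t * M <= (p i).[t].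
  have [q pE] : exists q, p i = q * 'X + (p i).[0]%:P.
    have /factor_theorem[q qE] : root (p i - (p i).[0]%:P) 0.
      by rewrite rootE !hornerE subrr.
    by exists q; rewrite -[LHS](subrK (p i).[0]%:P) qE subr0.
  have [M le_M] := poly_itv_bound q 0 1.
  exists M; split=> [|t t01].
    by apply: le_trans (le_M 0 _); rewrite // lexx ler01.
  rewrite [in leRHS]pE !hornerE addrC lerD2r mulrC -mulNr ler_wpM2r //.
    by case/andP: t01.
  by have := le_M t t01; rewrite ler_norml => /andP[].
have sum_ge0 : 0 <= \sum_i M i / (p i).[0].
  by apply: sumr_ge0 => i _; rewrite divr_ge0 ?(Mp i).1 // ltW.
(* This point works because M i / (p i).[0] is one of the terms of the sum s. *)
set s := \sum_i _ in sum_ge0; have s1_gt0 : 0 < 1 + s by rewrite ltr_pwDl.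
exists (1 + s)^-1; first by rewrite invr_gt0 s1_gt0 invf_le1 // lerDl.
move=> i; apply: lt_le_trans ((Mp i).2 _ _); last first.
  by rewrite invr_ge0 ltW // invf_le1 // lerDl.
rewrite subr_gt0 mulrC ltr_pdivrMr // mulrC -ltr_pdivrMr //.
apply: (@le_lt_trans _ _ s); last by rewrite ltrDr.
rewrite /s (bigD1 i) //= lerDl sumr_ge0 // => j _.
by rewrite divr_ge0 ?(Mp j).1 // ltW.
Qed.

(** Up to a power of ['X], a nonzero [q] is nonzero at 0, and then the square of
    the cofactor joins the family of polynomials that are positive at 0. *)
Lemma poly_pos_neq0_near0 (I : finType) (p : I -> {poly R}) (q : {poly R}) :
  (forall i, 0 < (p i).[0]) -> q != 0 ->
  exists t, [/\ 0 < t <= 1, forall i, 0 < (p i).[t] & q.[t] != 0].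
Proof.
move=> p_gt0 q_neq0; have [k [q']] := multiplicity_XsubC q 0.
rewrite q_neq0 /= => q'0 qE.
pose r i := if i is Some j then p j else q' ^+ 2.
have [|t t01 r_gt0] := @poly_pos_near0 (option I) r.
  case=> [j|]; rewrite /= ?horner_exp //.
  by rewrite lt_neqAle sqr_ge0 andbT eq_sym expf_eq0.
exists t; split=> // [i|]; first exact: (r_gt0 (Some i)).
have q't_neq0 : q'.[t] != 0.
  apply: contraTneq (r_gt0 None) => q't0.
  by rewrite /= horner_exp q't0 expr0n ltxx.
rewrite qE subr0 hornerM horner_exp hornerX mulf_neq0 // expf_neq0 //.
by rewrite gt_eqF //; case/andP: t01.
Qed.

(** The ring of polynomial functions has no zero divisors: on the line through a
    point where [f] is nonzero and one where [g] is, [f * g] is a nonzero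
    univariate polynomial. *)
Lemma polyfun_common_neq0 n l (F : 'I_l -> 'rV[R]_n -> R) :
  (forall i, polyfun (F i)) -> (forall i, exists u, F i u != 0) ->
  exists u, \prod_i F i u != 0.
Proof.
elim: l F => [|l IHl] F pF F_neq0; first by exists 0; rewrite big_ord0 oner_eq0.
have [i|i|u Fu] := IHl (fun i => F (lift ord0 i)); [exact: pF | exact: F_neq0 |].
have [v F0v] := F_neq0 ord0.
have [p pE] := polyfun_line u (v - u) (pF ord0).
have [q qE] : exists q : {poly R},
    forall t, \prod_(i < l) F (lift ord0 i) (u + t *: (v - u)) = q.[t].
  exact: polyfun_line (polyfun_prod _ (fun i => pF (lift ord0 i))).
have pq_neq0 : p * q != 0.
  rewrite mulf_neq0 //.
    apply: contraNneq F0v => p0.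
    by rewrite -(subrK u v) addrC -[v - u]scale1r pE p0 horner0.
  apply: contraNneq Fu => q0.
  apply/eqP; rewrite -[RHS](horner0 0) -q0 -qE.
  by under [RHS]eq_bigr do rewrite scale0r addr0.
have [|t [_ _]] := @poly_pos_neq0_near0 'I_0 (fun=> 0) (p * q) _ pq_neq0; first by case.
by rewrite hornerM -pE -qE => pqt; exists (u + t *: (v - u)); rewrite big_ord_recl.
Qed.

(** Write [u] as an affine combination of points of [S] and go from their
    barycentre, where all weights are positive, towards [u].  The weights remain
    positive for a while, so the segment starts inside [S], and [f] has only
    finitely many zeros on it. *)
Lemma polyfun_neq0_convex n (S : set 'rV[R]_n) (f : 'rV[R]_n -> R) u :
  conv_hull S `<=` S -> aff_hull S u -> polyfun f -> f u != 0 ->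
  exists2 y, S y & f y != 0.
Proof.
move=> cvxS [m [x [c [Sx c1 uE]]]] pf fu.
have mR_gt0 : 0 < m%:R :> R by rewrite ltr0n (sum1_ord_gt0 c1).
pose z := \sum_i m%:R^-1 *: x i.
have [p fp] := polyfun_line z (u - z) pf.
have p_neq0 : p != 0.
  apply: contraNneq fu => p0.
  by rewrite -(subrK z u) addrC -[u - z]scale1r fp p0 horner0.
have [i|t [_ c_gt0 pt_neq0]] := poly_pos_neq0_near0
    (p := fun i : 'I_m => (m%:R^-1)%:P + (c i - m%:R^-1) *: 'X) _ p_neq0.
  by rewrite !hornerE invr_gt0.
exists (z + t *: (u - z)); last by rewrite fp.
apply: cvxS; exists m, x, (fun i => m%:R^-1 + t * (c i - m%:R^-1)); split=> //.
- by move=> i; have := c_gt0 i; rewrite !hornerE mulrC => /ltW.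
- rewrite big_split /= -mulr_sumr sumrB c1 sumr_const card_ord -[_ *+ m]mulr_natr.
  by rewrite mulVf ?gt_eqF // subrr mulr0 addr0.
rewrite uE /z -sumrB scaler_sumr -big_split /=; apply: eq_bigr => i _.
by rewrite scalerDl -scalerA scalerBl.
Qed.

End Descriptions.

(** * Cylinders, cones and their base *)

Section CylindersAndCones.
Variables (R : realType) (d : nat).
Implicit Types (C : set 'rV[R]_(1 + d)) (Q : set 'rV[R]_d).

Definition cylinder Q : set 'rV[R]_(1 + d) :=
  [set w : 'rV[R]_(1 + d) | 0 <= w 0 0 <= 1 /\ Q (rsubmx w)].

Definition cone Q : set 'rV[R]_(1 + d) :=
  [set w : 'rV[R]_(1 + d) | 0 <= w 0 0 <= 1 /\
           exists2 q, Q q & rsubmx w = (1 - w 0 0) *: q].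

Lemma row_mx00 (a : 'M[R]_1) (u : 'rV_d) : (row_mx a u : 'rV_(1 + d)) 0 0 = a 0 0.
Proof. by rewrite -(lshift0 d 0) row_mxEl. Qed.

Lemma row_mx_head (w : 'rV[R]_(1 + d)) : row_mx (w 0 0)%:M (rsubmx w) = w.
Proof.
rewrite -[RHS]hsubmxK; congr row_mx.
by apply/rowP => i; rewrite !mxE ord1 lshift0 eqxx mulr1n.
Qed.

(** Near a point of [Q] where no [F i] vanishes, all [F i] are positive, so [C]
    would extend below the hyperplane of [Q]; hence some [F i] vanishes on that
    hyperplane and says nothing about [Q]. *)
Lemma described_facet C Q l :
  conv_hull Q `<=` Q -> aff_hull Q = setT ->
  (forall u, C (row_mx (0 : 'M[R]_1) u) <-> Q u) -> (forall w, C w -> 0 <= w 0 0) ->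
  described_by C l -> exists2 k, l = k.+1 & described_by Q k.
Proof.
move=> cvxQ affQ CQ C_ge0 /described_byP[F [pF CE]].
have pmap0 : polymap (fun u : 'rV[R]_d => row_mx (0 : 'rV[R]_1) u).
  apply: polymap_row_mx => j; last exact: polyfun_coord.
  by under eq_fun do rewrite mxE; exact: polyfun_const.
have pF0 i : polyfun (fun u => F i (row_mx 0 u)) by exact: polyfun_comp.
have [i Fi0] : exists i, forall u, F i (row_mx 0 u) = 0.
  apply: contrapT => F0.
  have F_neq0 i : exists u, F i (row_mx 0 u) != 0.
    apply: contrapT => Fi0; apply: F0; exists i => u; apply/eqP/negPn/negP => Fiu.
    by apply: Fi0; exists u.
  have [u Fu] := polyfun_common_neq0 pF0 F_neq0.
  have [y Qy Fy] : exists2 y, Q y & \prod_i F i (row_mx 0 y) != 0.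
    apply: polyfun_neq0_convex cvxQ _ _ Fu; first by rewrite affQ.
    exact: polyfun_prod.
  have /choice[p pE] i := polyfun_line (row_mx 0 y) (row_mx (- 1%:M) 0) (pF i).
  have [i|t /andP[t_gt0 _] pt_gt0] := @poly_pos_near0 R 'I_l p.
    have := (CQ y).2 Qy; rewrite CE /= => /(_ i); rewrite le_eqVlt => /orP[|].
      by move/prodf_neq0: Fy => /(_ i isT)/negPf; rewrite eq_sym => ->.
    by rewrite -pE scale0r addr0.
  have /C_ge0 : C (row_mx 0 y + t *: row_mx (- 1%:M) 0).
    by rewrite CE => i /=; rewrite pE ltW.
  rewrite scale_row_mx add_row_mx row_mx00 !mxE eqxx add0r mulrN1.
  by rewrite oppr_ge0 leNgt t_gt0.
case: l F pF CE pF0 i Fi0 => [|k] F pF CE pF0 i Fi0; first by case: i Fi0.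
exists k => //; apply/described_byP.
exists (fun j u => F (lift i j) (row_mx 0 u)); split=> //.
apply/seteqP; split=> u /=.
  by move=> /CQ; rewrite CE /= => Fu j.
move=> Fu; apply/CQ; rewrite CE /= => j.
by case: (unliftP i j) => [j' ->//|->]; rewrite Fi0.
Qed.

Lemma described_cylinder Q l :
  described_by Q l -> described_by (cylinder Q) l.+1.
Proof.
move=> dQ.
have -> : cylinder Q =
    (@rsubmx R 1 1 d) @^-1` Q `&` [set w : 'rV[R]_(1 + d) | 0 <= w 0 0 * (1 - w 0 0)].
  apply/seteqP; split=> w /= => [[/andP[w0 w1] Qw]|[Qw ww]].
    by split=> //; rewrite mulr_ge0 // subr_ge0.
  by split=> //; nra.
apply: described_setI; last exact: described_preimage (@polymap_rsubmx _ _ _) dQ.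
apply: polyfunM; first exact: polyfun_coord.
by apply: polyfunD; [exact: polyfun_const | apply: polyfunN; exact: polyfun_coord].
Qed.

(** The slices with [w 0 0 < 1] come from homogenizing a description of [Q]; the
    factor [1 + (1 - w 0 0) ^+ 2] in [g] makes the bracket positive on the whole
    open cone, both near the apex and far below the base. *)
Lemma described_cone Q l c :
  Q !=set0 -> 0 < c -> (forall q, Q q -> c * \sum_j q 0 j ^+ 2 <= 1) ->
  described_by Q l -> described_by (cone Q) l.+1.
Proof.
move=> [q0 Qq0] c_gt0 Qc /described_byP[F [pF QE]].
have /choice[h hP] i := polyfun_perspective (pF i).
pose flip (w : 'rV[R]_(1 + d)) : 'rV[R]_(1 + d) := row_mx (1 - w 0 0)%:M (rsubmx w).
pose nrm (u : 'rV[R]_d) := \sum_j u 0 j ^+ 2.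
pose g (w : 'rV[R]_(1 + d)) :=
  w 0 0 * ((1 - w 0 0) * (1 + (1 - w 0 0) ^+ 2) - c * nrm (rsubmx w)).
have nrm_ge0 u : 0 <= nrm u by apply: sumr_ge0 => j _; exact: sqr_ge0.
have nrmZ s u : nrm (s *: u) = s ^+ 2 * nrm u.
  by rewrite /nrm mulr_sumr; apply: eq_bigr => j _; rewrite mxE exprMn.
have nrm0 : nrm 0 = 0 by rewrite /nrm big1 // => j _; rewrite mxE expr0n.
have nrm_eq0 u : nrm u <= 0 -> u = 0.
  move=> u0; apply/rowP => j; rewrite mxE; apply/eqP; rewrite -sqrf_eq0.
  have /eqP : nrm u = 0 by apply/eqP; rewrite eq_le u0 nrm_ge0.
  by rewrite psumr_eq0 => [/allP/(_ j)|? _]; rewrite ?mem_index_enum ?sqr_ge0 //; exact.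
have pcoord0 : polyfun (fun w : 'rV[R]_(1 + d) => w 0 0) by exact: polyfun_coord.
have pflip0 : polyfun (fun w : 'rV[R]_(1 + d) => 1 - w 0 0).
  by apply: polyfunD; [exact: polyfun_const | exact: polyfunN].
have -> : cone Q =
    [set w : 'rV[R]_(1 + d) | forall i, 0 <= h i (flip w)] `&`
    [set w | 0 <= g w].
  apply/seteqP; split=> w /=.
    move=> [/andP[w0 w1] [q Qq wq]]; split=> [i|].
      have [_ hi0 hiE] := hP i; rewrite /flip.
      have [s_gt0|s_le0] := ltP 0 (1 - w 0 0).
        rewrite hiE // wq scalerA mulVf ?gt_eqF // scale1r.
        by move: Qq; rewrite QE.
      have s0 : 1 - w 0 0 = 0 by apply/eqP; rewrite eq_le s_le0 subr_ge0.
      by rewrite wq s0 scale0r -[X in row_mx X](scalemx1) scale0r row_mx0 hi0.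
    rewrite /g wq nrmZ mulr_ge0 //.
    have := Qc q Qq; rewrite -/(nrm q); set s := 1 - w 0 0 => cq.
    have s_ge0 : 0 <= s by rewrite subr_ge0.
    have : s ^+ 2 * (c * nrm q) <= s ^+ 2 by rewrite ler_piMr // sqr_ge0.
    by nra.
  move=> [hw gw].
  have Qs : 0 < 1 - w 0 0 -> Q ((1 - w 0 0)^-1 *: rsubmx w).
    by move=> s_gt0; rewrite QE => i /=; have [_ _ <-] := hP i.
  (* Below the base the bracket of g is positive on the cone, so g is negative. *)
  have w0 : 0 <= w 0 0.
    rewrite leNgt; apply/negP => w_lt0.
    have s_gt0 : 0 < 1 - w 0 0 by rewrite subr_gt0 (lt_trans w_lt0).
    have := Qc _ (Qs s_gt0); rewrite -/(nrm _) nrmZ exprVn mulrCA.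
    rewrite ler_pdivrMl ?exprn_gt0 // mulr1.
    move: gw; rewrite /g nmulr_rge0 //; move: s_gt0; set s := 1 - w 0 0.
    by set cn := c * _ => *; nra.
  have [s_gt0|s_le0] := ltP 0 (1 - w 0 0).
    split; first by rewrite w0 -subr_ge0 ltW.
    exists ((1 - w 0 0)^-1 *: rsubmx w); first exact: Qs.
    by rewrite scalerA mulfV ?gt_eqF // scale1r.
  (* At or beyond the apex level only the apex makes the bracket nonnegative. *)
  have w_gt0 : 0 < w 0 0 by lra.
  move: gw; rewrite /g pmulr_rge0 // => gw.
  have cn_ge0 : 0 <= c * nrm (rsubmx w) by rewrite mulr_ge0 // ltW.
  have s0 : 1 - w 0 0 = 0.
    apply/eqP; rewrite eq_le s_le0 -(@pmulr_lge0 _ (1 + (1 - w 0 0) ^+ 2)).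
      by apply: le_trans cn_ge0 _; rewrite -subr_ge0.
    by rewrite ltr_pwDl // sqr_ge0.
  have u0 : rsubmx w = 0.
    by apply: nrm_eq0; rewrite -(pmulr_rle0 _ c_gt0); move: gw; rewrite s0; lra.
  split; first by lra.
  by exists q0; rewrite // u0 s0 scale0r.
apply: described_setI.
  apply: polyfunM => //; apply: polyfunD.
    apply: polyfunM => //; apply: polyfunD; [exact: polyfun_const | exact: polyfunX].
  apply: polyfunN; apply: polyfunM; first exact: polyfun_const.
  by apply: polyfun_sum => j; apply: polyfunX; exact: polymap_rsubmx.
apply/described_byP; exists (fun i w => h i (flip w)); split=> // i.
have [ph _ _] := hP i; apply: polyfun_comp ph _.
by apply: polymap_row_mx; [exact: polymap_scalar | exact: polymap_rsubmx].
Qed.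

(** The slice of a convex combination of [x i] is a mean of points of [Q] with the
    weights [c i * (1 - x i 0 0)], which need renormalizing; at the apex level they
    all vanish, and any point of [Q] will do. *)
Lemma cone_convex Q : conv_hull Q `<=` Q -> conv_hull (cone Q) `<=` cone Q.
Proof.
move=> cvxQ w [m [x [c [Cx c_ge0 c1 ->]]]].
have /choice[q qP] i : exists q, Q q /\ rsubmx (x i) = (1 - x i 0 0) *: q.
  by have [_ [q Qq xq]] := Cx i; exists q.
pose e i := c i * (1 - x i 0 0).
have e_ge0 i : 0 <= e i.
  by rewrite mulr_ge0 // subr_ge0; have [/andP[]] := Cx i.
set y := \sum_i _; have y0 : y 0 0 = \sum_i c i * x i 0 0.
  by rewrite summxE; apply: eq_bigr => i _; rewrite mxE.
have sE : 1 - y 0 0 = \sum_i e i.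
  by rewrite y0 -c1 -sumrB; apply: eq_bigr => i _; rewrite /e mulrBr mulr1.
have uE : rsubmx y = \sum_i e i *: q i.
  rewrite linear_sum; apply: eq_bigr => i _.
  by rewrite linearZ /= (qP i).2 scalerA.
have s_ge0 : 0 <= 1 - y 0 0 by rewrite sE sumr_ge0.
split.
  rewrite -[y 0 0 <= 1]subr_ge0 s_ge0 andbT y0 sumr_ge0 // => i _.
  by rewrite mulr_ge0 //; have [/andP[]] := Cx i.
have [s0|s_neq0] := eqVneq (1 - y 0 0) 0.
  exists (q (Ordinal (sum1_ord_gt0 c1))); first exact: (qP _).1.
  have /eqP : \sum_i e i = 0 by rewrite -sE.
  rewrite psumr_eq0 // => /allP e0.
  rewrite s0 scale0r uE big1 // => i _.
  by have /eqP-> := e0 i (mem_index_enum _); rewrite scale0r.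
exists (\sum_i (e i / (1 - y 0 0)) *: q i).
  apply: cvxQ; exists m, q, (fun i => e i / (1 - y 0 0)); split=> //.
  - by move=> i; exact: (qP i).1.
  - by move=> i; rewrite divr_ge0.
  - by rewrite -mulr_suml -sE mulfV.
rewrite uE scaler_sumr; apply: eq_bigr => i _.
by rewrite scalerA mulrCA mulfV // mulr1.
Qed.

End CylindersAndCones.

(** * Affine charts *)

Section Charts.
Variable R : realType.

Definition chart n k (a : 'rV[R]_n) (A : 'M[R]_(k, n)) (u : 'rV[R]_k) : 'rV[R]_n :=
  a + u *m A.

Lemma chart_inj n k (a : 'rV[R]_n) (A : 'M[R]_(k, n)) :
  row_free A -> injective (chart a A).
Proof. by move=> freeA u u' /addrI /(row_free_inj freeA). Qed.

Lemma chart_sum n k (a : 'rV[R]_n) (A : 'M[R]_(k, n)) m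
    (c : 'I_m -> R) (u : 'I_m -> 'rV[R]_k) :
  \sum_i c i = 1 ->
  \sum_i c i *: chart a A (u i) = chart a A (\sum_i c i *: u i).
Proof.
move=> c1; rewrite /chart mulmx_suml -[a in RHS]scale1r -c1 scaler_suml -big_split.
by apply: eq_bigr => i _; rewrite /= scalerDr scalemxAl.
Qed.

Lemma sub_aff_hull n (S : set 'rV[R]_n) : S `<=` aff_hull S.
Proof.
move=> x Sx; exists 1%N, (fun=> x), (fun=> 1).
by rewrite !big_ord1 scale1r.
Qed.

Lemma aff_hull_chart n k (S : set 'rV[R]_n) (a : 'rV[R]_n) (A : 'M[R]_(k, n)) :
  S `<=` range (chart a A) -> aff_hull S `<=` range (chart a A).
Proof.
move=> SA y [m [x [c [Sx c1 ->]]]].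
have /choice[u uE] i : exists u, x i = chart a A u.
  by have [u _ <-] := SA _ (Sx i); exists u.
by under eq_bigr do rewrite uE; rewrite chart_sum //; exists (\sum_i c i *: u i).
Qed.

Lemma aff_hull_preimage n k (S : set 'rV[R]_n) (a : 'rV[R]_n) (A : 'M[R]_(k, n)) :
  row_free A -> aff_hull S = range (chart a A) ->
  aff_hull (chart a A @^-1` S) = setT.
Proof.
move=> freeA affS; apply/seteqP; split=> // u _.
have [m [x [c [Sx c1 uE]]]] : aff_hull S (chart a A u) by rewrite affS; exists u.
have /choice[v vE] i : exists v, x i = chart a A v.
  by have := sub_aff_hull (Sx i); rewrite affS => -[v _ <-]; exists v.
exists m, v, c; split=> //; first by move=> i; rewrite /= -vE.
apply: (chart_inj freeA (a := a)); rewrite uE -chart_sum //.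
by apply: eq_bigr => i _; rewrite vE.
Qed.

Lemma convex_preimage n k (S : set 'rV[R]_n) (a : 'rV[R]_n) (A : 'M[R]_(k, n)) :
  conv_hull S `<=` S -> conv_hull (chart a A @^-1` S) `<=` chart a A @^-1` S.
Proof.
move=> cvxS u [m [v [c [Sv c_ge0 c1 ->]]]] /=; rewrite -chart_sum //.
by apply: cvxS; exists m, (fun i => chart a A (v i)), c.
Qed.

Lemma range_chart_submx n k k' (a a' : 'rV[R]_n) (A : 'M[R]_(k, n)) (A' : 'M[R]_(k', n)) :
  range (chart a A) `<=` range (chart a' A') -> (A <= A')%MS.
Proof.
move=> AA'.
have [u0 _ u0E] : range (chart a' A') a.
  by apply: AA'; exists 0; rewrite // /chart mul0mx addr0.
apply/row_subP => i; have [u _] : range (chart a' A') (chart a A (delta_mx 0 i)).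
  by apply: AA'; exists (delta_mx 0 i).
rewrite /chart -rowE => uE; apply/submxP; exists (u - u0).
by apply: (addrI a); rewrite -uE mulmxBl -[in RHS]u0E /chart addrACA subrr addr0.
Qed.

Lemma has_dim_uniq n (S : set 'rV[R]_n) k k' : has_dim S k -> has_dim S k' -> k = k'.
Proof.
suff le_dim i j : has_dim S i -> has_dim S j -> (i <= j)%N.
  by move=> Sk Sk'; apply/eqP; rewrite eqn_leq !le_dim.
move=> [a [A [/eqP rkA SA]]] [b [B [_ SB]]]; rewrite -rkA.
have AB : range (chart a A) `<=` range (chart b B).
  by rewrite -[range (chart b B)]SB -[range (chart a A)]SA.
exact: leq_trans (mxrankS (range_chart_submx AB)) (rank_leq_row B).
Qed.

(** Any affine embedding of [S] into its own dimension differs from the inverse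
    of a chart by an affine map, along which a description can be pulled back. *)
Lemma polynomial_descriptionE n k (S : set 'rV[R]_n) (a : 'rV[R]_n) (A : 'M[R]_(k, n)) l :
  row_free A -> aff_hull S = range (chart a A) ->
  polynomial_description S l <-> described_by (chart a A @^-1` S) l.
Proof.
move=> freeA affS; have dimS : has_dim S k by exists a, A.
split=> [[[_]|[k' [_ dimS' [f [[[B [b fE]] finj]]]]]]|].
- by apply: described_preimage; exact: polymap_affine.
- rewrite (has_dim_uniq dimS' dimS) in f B b fE finj * => dfS.
  suff -> : chart a A @^-1` S = (fun u => f (chart a A u)) @^-1` (f @` S).
    apply: described_preimage dfS => j.
    under eq_fun do rewrite fE /chart mulmxDl -mulmxA addrAC.
    exact: polymap_affine.
  apply/seteqP; split=> u /=; first by exists (chart a A u).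
  move=> [x Sx fx]; suff <- : x = chart a A u by [].
  apply: finj fx; rewrite inE; first exact: sub_aff_hull.
  by rewrite affS; exists u.
(* g is the inverse of the chart, extended affinely to the whole space. *)
move=> dS; pose g x := - (a *m pinvmx A) + x *m pinvmx A.
have gK u : g (chart a A u) = u.
  by rewrite /g /chart mulmxDl -mulmxA mulmxVp // mulmx1 addKr.
have gS x : aff_hull S x -> chart a A (g x) = x.
  by rewrite affS => -[u _ <-]; rewrite gK.
have [kn|kn] := ltnP k n.
  right; exists k; split=> //; exists g; split.
    split; first by exists (pinvmx A), (- (a *m pinvmx A)) => x; rewrite addrC.
    by move=> x y; rewrite !inE => /gS xE /gS yE gxy; rewrite -xE -yE gxy.
  suff -> : g @` S = chart a A @^-1` S by [].
  apply/seteqP; split=> [_ [x Sx <-]|u Su] /=; first by rewrite gS //; exact: sub_aff_hull.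
  by exists (chart a A u).
have eqkn : k = n by apply/eqP; rewrite eqn_leq kn andbT -(eqP freeA) rank_leq_col.
subst k; left; split=> //.
have -> : S = g @^-1` (chart a A @^-1` S); last first.
  by apply: described_preimage dS; exact: polymap_affine.
have affT x : aff_hull S x.
  rewrite affS; exists ((x - a) *m invmx A) => //.
  by rewrite /chart mulmxKV -?row_free_unit // addrC subrK.
by apply/seteqP; split=> x /=; rewrite gS.
Qed.

Lemma mP_least n (S : set 'rV[R]_n) l :
  polynomial_description S l ->
  (forall l', polynomial_description S l' -> (l <= l')%N) -> mP S = l.
Proof.
move=> dS le_l; rewrite /mP; case: xgetP => [m _ [dm le_m]|/(_ l)[]//].
by apply/eqP; rewrite eqn_leq le_m // le_l.
Qed.

Lemma described_least n (S : set 'rV[R]_n) :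
  (exists l, described_by S l) ->
  exists l, described_by S l /\ forall l', described_by S l' -> (l <= l')%N.
Proof.
move=> [l0 dl0].
have exP : exists l, `[< described_by S l >] by exists l0; apply/asboolP.
exists (ex_minn exP); case: ex_minnP => l /asboolP dl le_l; split=> // l' dl'.
by apply: le_l; apply/asboolP.
Qed.

(** The chart has an affine left inverse, which maps bounded sets to bounded
    sets; only the Euclidean consequence used for cones is recorded. *)
Lemma bounded_preimage n k (S : set 'rV[R]_n) (a : 'rV[R]_n) (A : 'M[R]_(k, n)) :
  row_free A -> bounded_set S ->
  exists2 c, 0 < c &
    forall u, (chart a A @^-1` S) u -> c * \sum_j u 0 j ^+ 2 <= 1.
Proof.
move=> freeA /ex_strict_bound_gt0[M _ SM].
have coordM x i : S x -> `|x 0 i| <= M.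
  move=> /SM /ltW; apply: le_trans; rewrite [leRHS]/Num.norm /= mx_normrE.
  by apply/bigmax_geP; right => /=; exists (0, i).
pose b j := \sum_i (M + `|a 0 i|) * `|pinvmx A i j|.
have ub u j : (chart a A @^-1` S) u -> `|u 0 j| <= b j.
  move=> Su; have -> : u = (chart a A u - a) *m pinvmx A.
    by rewrite /chart [a + _]addrC addrK -mulmxA mulmxVp // mulmx1.
  rewrite mxE; apply: le_trans (ler_norm_sum _ _ _) _; apply: ler_sum => i _.
  rewrite normrM ler_wpM2r // [(_ - a) 0 i]mxE [(- a) 0 i]mxE.
  by apply: le_trans (ler_normB _ _) _; rewrite lerD2r; exact: coordM.
have s_ge0 : 0 <= \sum_j b j ^+ 2 by apply: sumr_ge0 => j _; exact: sqr_ge0.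
have s1_gt0 : 0 < 1 + \sum_j b j ^+ 2 by rewrite ltr_pwDl.
exists (1 + \sum_j b j ^+ 2)^-1; first by rewrite invr_gt0.
move=> u Su; rewrite ler_pdivrMl // mulr1.
apply: le_trans (_ : \sum_j b j ^+ 2 <= _); last by rewrite lerDr.
apply: ler_sum => j _; rewrite -[leLHS]real_normK ?num_real //.
by rewrite lerXn2r ?nnegrE ?ub // (le_trans _ (ub u j Su)).
Qed.

End Charts.

(** * Prisms and pyramids *)

Section PrismsAndPyramids.
Variables (R : realType) (d : nat).
Implicit Types P Q : set 'rV[R]_d.+1.

Lemma chart_col_mx (a v : 'rV[R]_d.+1) (A : 'M[R]_(d, d.+1)) (w : 'rV[R]_(1 + d)) :
  chart a (col_mx v A) w = chart a A (rsubmx w) + w 0 0 *: v.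
Proof.
rewrite /chart -[w in LHS]row_mx_head mul_row_col mul_scalar_mx -addrA.
by rewrite [_ *: v + _]addrC.
Qed.

Lemma prism_cylinder P Q (a v : 'rV[R]_d.+1) (A : 'M[R]_(d, d.+1)) :
  aff_hull Q = range (chart a A) ->
  P = [set q + l *: v | q in Q & l in [set l : R | 0 <= l <= 1]] ->
  P = chart a (col_mx v A) @` cylinder (chart a A @^-1` Q).
Proof.
move=> affQ ->; apply/seteqP; split=> [_ [q Qq [l l01 <-]]|_ [w [w01 Qw] <-]].
  have [u _ uE] : range (chart a A) q by rewrite -affQ; exact: sub_aff_hull.
  exists (row_mx l%:M u).
    by split; rewrite ?row_mx00 ?row_mxKr ?mxE ?eqxx //= uE.
  by rewrite chart_col_mx row_mxKr row_mx00 mxE eqxx uE.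
by rewrite chart_col_mx; exists (chart a A (rsubmx w)) => //; exists (w 0 0).
Qed.

Lemma pyramid_cone P Q (a v : 'rV[R]_d.+1) (A : 'M[R]_(d, d.+1)) :
  Q !=set0 -> conv_hull Q `<=` Q -> aff_hull Q = range (chart a A) ->
  P = conv_hull (Q `|` [set v]) ->
  P = chart a (col_mx (v - a) A) @` cone (chart a A @^-1` Q).
Proof.
move=> [q0 Qq0] cvxQ affQ ->; apply/seteqP; split=> [y [m [x [c [Sx c_ge0 c1 ->]]]]|].
  have QE q : Q q -> exists u, q = chart a A u.
    by move=> /sub_aff_hull; rewrite affQ => -[u _ <-]; exists u.
  have /choice[w wP] i : exists w, cone (chart a A @^-1` Q) w /\
      x i = chart a (col_mx (v - a) A) w.
    have [/[dup] Qx /QE[u xE]|->] := Sx i.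
      exists (row_mx (0 : 'M[R]_1) u).
      rewrite chart_col_mx row_mxKr row_mx00 mxE scale0r addr0.
      split=> //; split; rewrite row_mx00 mxE; first by rewrite lexx ler01.
      by exists u; [rewrite /= -xE | rewrite row_mxKr subr0 scale1r].
    have [u qE] := QE _ Qq0.
    exists (row_mx (1%:M : 'M[R]_1) 0); split; last first.
      rewrite chart_col_mx row_mxKr row_mx00 mxE eqxx scale1r.
      by rewrite /chart mul0mx addr0 addrC subrK.
    split; rewrite row_mx00 mxE eqxx; first by rewrite lexx ler01.
    by exists u; [rewrite /= -qE | rewrite row_mxKr subrr scale0r].
  exists (\sum_i c i *: w i); last first.
    by rewrite -chart_sum //; apply: eq_bigr => i _; rewrite (wP i).2.
  apply: cone_convex; first exact: convex_preimage.
  by exists m, w, c; split=> // i; exact: (wP i).1.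
move=> _ [w [w01 [u Qu uE]] <-].
exists 2%N, (fun i => if i == ord0 then chart a A u else v),
  (fun i => if i == ord0 then 1 - w 0 0 else w 0 0); split.
- by move=> i; case: ifP => _; [left | right].
- by move=> i; case: ifP => _; case/andP: w01; rewrite ?subr_ge0.
- by rewrite big_ord_recl big_ord1 /= subrK.
rewrite big_ord_recl big_ord1 /= chart_col_mx uE /chart -scalemxAl.
rewrite scalerBr [in RHS]scalerDr [in RHS](scalerBl _ _ a) scale1r addrAC [RHS]addrAC.
by congr (_ + _); rewrite -addrA [- _ + _]addrC.
Qed.

(** [C] is [P] seen in the chart [col_mx v A].  That this chart is invertible,
    i.e. that [v] leaves the hyperplane of [Q], follows from the dimension
    of [P]. *)
Lemma mP_over_base P Q (a v : 'rV[R]_d.+1) (A : 'M[R]_(d, d.+1))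
    (C : set 'rV[R]_(1 + d)) :
  let Q0 := chart a A @^-1` Q in
  has_dim P d.+1 -> polyhedron Q -> row_free A -> aff_hull Q = range (chart a A) ->
  P = chart a (col_mx v A) @` C ->
  (forall u, C (row_mx (0 : 'M[R]_1) u) <-> Q0 u) -> (forall w, C w -> 0 <= w 0 0) ->
  (forall l, described_by Q0 l -> described_by C l.+1) ->
  mP P = (mP Q + 1)%N.
Proof.
move=> Q0 [b [B [freeB affP]]] polyQ freeA affQ PC CQ C_ge0 dC.
set M := col_mx v A in PC *.
have PM : aff_hull P `<=` range (chart a M).
  by apply: aff_hull_chart; rewrite PC => _ [w _ <-]; exists w.
have freeM : row_free M.
  have BM : (B <= M)%MS by apply: (@range_chart_submx _ _ _ _ b a); rewrite -affP.
  rewrite /row_free eqn_leq rank_leq_row /=.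
  by apply: leq_trans (mxrankS BM); rewrite (eqP freeB).
have affPM : aff_hull P = range (chart a M).
  apply/seteqP; split=> // x _; rewrite affP; exists ((x - b) *m invmx B) => //.
  by rewrite mulmxKV -?row_free_unit // addrC subrK.
have descP l : polynomial_description P l <-> described_by C l.
  rewrite (polynomial_descriptionE _ freeM affPM).
  suff -> : chart a M @^-1` P = C by [].
  apply/seteqP; split=> w /=; rewrite PC; last by exists w.
  by move=> [w' Cw' /(chart_inj freeM) <-].
have descQ l := polynomial_descriptionE l freeA affQ.
have [l [dl le_l]] : exists l, described_by Q0 l /\
    forall l', described_by Q0 l' -> (l <= l')%N.
  apply: described_least; have [l dQ] := polyhedron_described polyQ.
  by exists l; apply: described_preimage dQ; exact: polymap_affine.
have -> : mP Q = l by apply: mP_least => [|l' /descQ]; [exact/descQ | exact: le_l].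
rewrite addn1; apply: mP_least; first by apply/descP; exact: dC.
have cvxQ0 := convex_preimage (a := a) (A := A) (polyhedron_convex polyQ).
have affQ0 := aff_hull_preimage freeA affQ.
by move=> l' /descP /(described_facet cvxQ0 affQ0 CQ C_ge0)[k -> /le_l].
Qed.

End PrismsAndPyramids.

Theorem proposition2p3 (R : realType) (d : nat) (P Q : set 'rV[R]_d.+1) :
  prism P Q \/ pyramid P Q -> mP P = (mP Q + 1)%N.
Proof.
case=> -[[_ dimP] [[polyQ bndQ] [a [A [freeA affQ]]]] [v PE]].
  apply: (mP_over_base dimP polyQ freeA affQ (prism_cylinder affQ PE)).
  - move=> u; rewrite /cylinder /= row_mx00 row_mxKr mxE lexx ler01.
    by split=> [[]|].
  - by move=> w [/andP[]].
  - by move=> l; exact: described_cylinder.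
have Q_neq0 : Q !=set0.
  have : aff_hull Q a by rewrite affQ; exists 0; rewrite // mul0mx addr0.
  by move=> [m [x [c [Qx /sum1_ord_gt0 m_gt0 _]]]]; exists (x (Ordinal m_gt0)).
have cvxQ := polyhedron_convex polyQ.
apply: (mP_over_base dimP polyQ freeA affQ (pyramid_cone Q_neq0 cvxQ affQ PE)).
- move=> u; rewrite /cone /= row_mx00 row_mxKr mxE lexx ler01 subr0.
  split=> [[_ [q Qq ->]]|Qu]; first by rewrite scale1r.
  by split=> //; exists u; rewrite ?scale1r.
- by move=> w [/andP[]].
move=> l; have [c c_gt0 cQ] := bounded_preimage a freeA bndQ.
apply: described_cone c_gt0 cQ.
have [q Qq] := Q_neq0.
have : aff_hull Q q by exact: sub_aff_hull.
by rewrite affQ => -[u _ uE]; exists u; rewrite /= /chart uE.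
Qed.
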